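(* For all integers $n,k\ge 1$ there is a bijection between $\mathcal{L}_{n,k}(12\cdots(k+1)(k+2))$ and the set of standard Young tableaux of shape $\langle (k+1)^n\rangle$, and hence $|\mathcal{L}_{n,k}(12\cdots(k+2))| = f^{\langle (k+1)^n\rangle}$.
   Context: A word $w$ contains a pattern $p\in S_m$ if some subsequence of $w$ of length $m$ is order-isomorphic to $p$; otherwise $w$ avoids $p$. For a set $S$ of permutations, $S(p)$ denotes the set of elements of $S$ avoiding $p$. For $n,k\ge 1$, $\mathcal{L}_{n,k}\subseteq S_{nk}$ is the set of permutations $w=w_{1,1}w_{1,2}\cdots w_{1,k}w_{2,1}\cdots w_{n,k}$ (written in $n$ consecutive blocks of length $k$) such that (L1) $w_{i,j}<w_{i,j+1}$ for all $1\le i\le n$, $1\le j\le k-1$, and (L2) $w_{i,j+1}>w_{i+1,j}$ for all $1\le i\le n-1$, $1\le j\le k-1$. $f^{\lambda}$ denotes the number of standard Young tableaux of shape $\lambda$; $\langle (k+1)^n\rangle$ is the rectangle with $n$ rows of length $k+1$. *)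

(* Defs.v *)
From mathcomp Require Import all_boot all_fingroup.

Set Implicit Arguments.
Unset Strict Implicit.
Unset Printing Implicit Defensive.

(* Permutations are read in one-line notation, positions and values being
   numbered from 0: the permutation w : 'S_N is the word w 0, w 1, .., w N.-1.
   In particular 12...m is the identity of 'S_m. *)

Section Patterns.

Variables (N m : nat).

(* The subsequence is given by its strictly increasing positions f. *)
Definition contains (w : 'I_N -> nat) (p : 'S_m) : bool :=
  [exists f : {ffun 'I_m -> 'I_N},
    [forall a : 'I_m, forall b : 'I_m, (a < b) ==> (f a < f b)] &&
    [forall a : 'I_m, forall b : 'I_m, (w (f a) < w (f b)) == (p a < p b)]].

Definition avoids (w : 'I_N -> nat) (p : 'S_m) : bool := ~~ contains w p.

Definition avoiders (S : {set 'S_N}) (p : 'S_m) : {set 'S_N} :=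
  [set w in S | avoids (fun i => w i) p].

End Patterns.

Section Blocks.

Variables (n k : nat).

Lemma block_pos_subproof (i : 'I_n) (j : 'I_k) : i * k + j < n * k.
Proof.
apply: (@leq_trans (i.+1 * k)); last by rewrite leq_mul2r ltn_ord orbT.
by rewrite mulSn addnC ltn_add2r.
Qed.

Definition block_pos (i : 'I_n) (j : 'I_k) : 'I_(n * k) :=
  Ordinal (block_pos_subproof i j).

Definition entry (w : 'S_(n * k)) (i : 'I_n) (j : 'I_k) : nat :=
  w (block_pos i j).

Definition L1 (w : 'S_(n * k)) : bool :=
  [forall i : 'I_n, forall j : 'I_k, forall j' : 'I_k,
    (j' == j.+1 :> nat) ==> (entry w i j < entry w i j')].

Definition L2 (w : 'S_(n * k)) : bool :=
  [forall i : 'I_n, forall i' : 'I_n, forall j : 'I_k, forall j' : 'I_k,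
    (i' == i.+1 :> nat) && (j' == j.+1 :> nat) ==>
      (entry w i j' > entry w i' j)].

Definition Lset : {set 'S_(n * k)} := [set w | L1 w && L2 w].

End Blocks.

(* A shape is the list of its row lengths, meant to be nonincreasing. *)
Section Tableaux.

Variable la : seq nat.

Definition cell : finType := {i : 'I_(size la) & 'I_(nth 0 la i)}.

Definition row (c : cell) : nat := tag c.
Definition col (c : cell) : nat := tagged c.

(* Entries are numbered from 0: 'I_(sumn la) stands for {1, .., |la|}. *)
Definition filling : finType := {ffun cell -> 'I_(sumn la)}.

Definition is_syt (T : filling) : bool :=
  [&& [forall v : 'I_(sumn la), #|[set c : cell | T c == v]| == 1],
      [forall c : cell, forall d : cell,
        (row c == row d) && (col c < col d) ==> (T c < T d)]
    & [forall c : cell, forall d : cell,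
        (col c == col d) && (row c < row d) ==> (T c < T d)]].

Definition SYT : {set filling} := [set T | is_syt T].

Definition num_syt : nat := #|SYT|.

End Tableaux.

Definition rectangle (n m : nat) : seq nat := nseq n m.

(* Main.v *)
Require Import Defs.
From mathcomp Require Import all_boot all_fingroup.
From mathcomp Require Import zify.

Set Implicit Arguments.
Unset Strict Implicit.
Unset Printing Implicit Defensive.

(* Two consecutive increasing blocks violating (L2) contain an increasing
   subsequence of length [k+2], so (L2) follows from (L1) and the avoidance. Under
   RSK, [w] goes to a pair (P, Q) whose first row has at most [k+1] cells, and the
   blocks of [w] are increasing iff in Q every block is a horizontal strip. Such a
   strip of size [k] in at most [k+1] columns turns a shape c' into a shape c
   contained, with exactly one box missing, in c' pushed down by a full row of
   length [k+1]. Hence the [n] missing boxes, read backwards, fill up the shape of P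
   to the [n] by [k+1] rectangle, and P followed by these boxes is an arbitrary
   standard tableau of that rectangle.

   RSK is encoded by words in row labels, following the local rules of Fomin's
   growth diagrams: only the row of each new box is recorded. *)

(** * Row insertion on words of row labels *)

(** The letters [1], [2], .. name rows, so every prefix must describe a partition shape. The letter
    [0] is unconstrained, as it marks absent values. *)
Definition lattice (s : seq nat) : Prop :=
  forall i r, count_mem r.+2 (take i s) <= count_mem r.+1 (take i s).

Lemma count_mem_rcons (r b : nat) (s : seq nat) :
  count_mem r (rcons s b) = count_mem r s + (b == r).
Proof. by rewrite -cats1 count_cat /= addn0. Qed.

Lemma lattice_count (s : seq nat) r :
  lattice s -> count_mem r.+2 s <= count_mem r.+1 s.
Proof. by move=> /(_ (size s) r); rewrite take_size. Qed.

Lemma take_rcons_le (s : seq nat) b i :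
  take i (rcons s b) = if i <= size s then take i s else rcons s b.
Proof.
case: leqP => h; first by rewrite -cats1 takel_cat.
by rewrite take_oversize // size_rcons.
Qed.

Lemma lattice_rcons (s : seq nat) b :
  lattice (rcons s b) <->
  lattice s /\
  forall r, count_mem r.+2 (rcons s b) <= count_mem r.+1 (rcons s b).
Proof.
split=> [h|[hs hb] i r].
  split=> [i r|r]; last exact: lattice_count.
  case: (leqP i (size s)) => hi; last first.
    by have := h (size s) r; rewrite take_rcons_le leqnn take_size take_oversize // ltnW.
  by have := h i r; rewrite take_rcons_le hi.
by rewrite take_rcons_le; case: ifP.
Qed.

Lemma lattice_cat (s t : seq nat) :
  lattice (s ++ t) <->
  lattice s /\
  forall i r, count_mem r.+2 s + count_mem r.+2 (take i t) <=
              count_mem r.+1 s + count_mem r.+1 (take i t).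
Proof.
split=> [h|[hs ht] i r].
  split=> i r; last first.
    by have := h (size s + i) r; rewrite takeD take_size_cat // drop_size_cat // !count_cat.
  case: (leqP i (size s)) => hi; first by have := h i r; rewrite takel_cat.
  by have := h (size s) r; rewrite take_size_cat // take_oversize // ltnW.
case: (leqP i (size s)) => hi; first by rewrite takel_cat.
by rewrite -(subnKC (ltnW hi)) takeD take_size_cat // drop_size_cat // !count_cat.
Qed.

(** One scan performs the whole bumping route, [a] being the row whose next entry is displaced.
    Insertion starts with [a = 0], as if the absent value were bumped out of a fictitious row
    [0]. *)
Fixpoint bump (a : nat) (s : seq nat) : seq nat :=
  if s is b :: s' then
    if b == a then a.+1 :: bump a.+1 s' else b :: bump a s'
  else [::].

(** The label at which the route stops, which is the row of the new box. *)
Fixpoint bump_end (a : nat) (s : seq nat) : nat :=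
  if s is b :: s' then bump_end (if b == a then a.+1 else a) s' else a.

(* A partial tableau is the word [v] with [v_j = i.+1] if the value [j] sits in
   row [i], and [v_j = 0] if [j] is absent. Bumping sends [j], of label [a], to
   the next row, from where it displaces the next larger entry of that row,
   i.e. the next occurrence of the label [a.+1]. *)
Definition ins (x : nat) (v : seq nat) : seq nat :=
  take x v ++ bump 0 (drop x v).

Definition lab (x : nat) (v : seq nat) : nat := bump_end 0 (drop x v).

(* The default value 1 forces [x < size v]. *)
Definition slot (x : nat) (v : seq nat) : bool := nth 1 v x == 0.

Lemma slot_lt x v : slot x v -> x < size v.
Proof. by rewrite /slot; case: ltnP => // h; rewrite nth_default. Qed.

Lemma slot_rcons x v b :
  slot x (rcons v b) = slot x v || ((x == size v) && (b == 0)).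
Proof.
rewrite /slot nth_rcons; case: ltngtP => h //=; first by rewrite orbF.
  by rewrite nth_default // ltnW.
by rewrite nth_default ?h.
Qed.

Lemma bump_rcons a s b :
  bump a (rcons s b) =
  rcons (bump a s) (if b == bump_end a s then b.+1 else b).
Proof.
elim: s a => [|c s IH] a /=; first by case: eqP => // ->.
by case: eqP => _; rewrite IH.
Qed.

Lemma bump_end_rcons a s b :
  bump_end a (rcons s b) = if b == bump_end a s then b.+1 else bump_end a s.
Proof. by elim: s a => [|c s IH] a /=; [case: eqP => // -> | rewrite IH]. Qed.

(** The local rule: a new largest value, sitting in row [b], is pushed down exactly when the new box
    would land in that same row. *)
Lemma ins_rcons x v b : slot x v ->
  ins x (rcons v b) = rcons (ins x v) (if b == lab x v then b.+1 else b).
Proof.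
move=> /slot_lt hx; rewrite /ins /lab drop_rcons ?(ltnW hx) // bump_rcons.
by rewrite take_rcons_le (ltnW hx) rcons_cat.
Qed.

Lemma lab_rcons x v b : slot x v ->
  lab x (rcons v b) = if b == lab x v then b.+1 else lab x v.
Proof. by move=> /slot_lt hx; rewrite /lab drop_rcons ?(ltnW hx) // bump_end_rcons. Qed.

Lemma ins_last v : ins (size v) (rcons v 0) = rcons v 1.
Proof. by rewrite /ins -!cats1 take_size_cat // drop_size_cat. Qed.

Lemma lab_last v : lab (size v) (rcons v 0) = 1.
Proof. by rewrite /lab -cats1 drop_size_cat. Qed.

(** Induction on the range of values: either [x] is the largest one, or a larger value, present or
    absent, is added on top. *)
Lemma slot_ind (P : nat -> seq nat -> Prop) :
  (forall v, P (size v) (rcons v 0)) ->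
  (forall x v b, slot x v -> P x v -> P x (rcons v b)) ->
  forall x v, slot x v -> P x v.
Proof.
move=> P0 PS x; elim/last_ind => [|v b IH]; first by rewrite /slot nth_nil.
rewrite slot_rcons => /orP[h|/andP[/eqP-> /eqP->]] //.
by apply: PS => //; apply: IH.
Qed.

Lemma size_ins x v : slot x v -> size (ins x v) = size v.
Proof.
elim/slot_ind => [u|y u b hs IH]; first by rewrite ins_last !size_rcons.
by rewrite ins_rcons // !size_rcons IH.
Qed.

Lemma lab_gt0 x v : slot x v -> 0 < lab x v.
Proof.
elim/slot_ind => [u|y u b hs IH]; first by rewrite lab_last.
by rewrite lab_rcons //; case: ifP.
Qed.

Lemma count_ins x v r : slot x v ->
  count_mem r.+1 (ins x v) = count_mem r.+1 v + (lab x v == r.+1).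
Proof.
elim/slot_ind => [u|y u b hs IH].
  by rewrite ins_last lab_last !count_mem_rcons addn0.
rewrite ins_rcons // lab_rcons // !count_mem_rcons IH.
by case: (b =P lab y u) => [->|_]; lia.
Qed.

(** Two different boxes that can be added to a shape can be added together. If they coincide, one
    moves to the next row, where the longer row above leaves room. *)
Lemma lattice_ins x v : slot x v -> lattice v -> lattice (ins x v).
Proof.
elim/slot_ind => [u|y u b hs IH] /lattice_rcons[hu hb].
  rewrite ins_last lattice_rcons; split=> // r.
  by have := hb r; rewrite !count_mem_rcons; lia.
have hi := IH hu; rewrite ins_rcons // lattice_rcons; split=> // r.
have := hb r; have := lattice_count r hi; have := lattice_count r hu.
rewrite !count_mem_rcons !count_ins //.
have := lab_gt0 hs; move: (lab y u) => l.
by case: (b =P l) => [->|]; lia.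
Qed.

Lemma slot_ins x v j : slot x v -> slot j (ins x v) = slot j v && (j != x).
Proof.
elim/slot_ind => [u|y u b hs IH].
  rewrite ins_last !slot_rcons andbF orbF.
  by have := @slot_lt j u; case: (slot j u) => /=; lia.
rewrite ins_rcons // !slot_rcons IH size_ins //.
have hy := slot_lt hs; have := @slot_lt j u; have := lab_gt0 hs.
by case: (b =P lab y u) => [->|]; case: (slot j u) => /=; lia.
Qed.

Lemma count_take_le (r : nat) i s : count_mem r (take i s) <= count_mem r s.
Proof. by rewrite -{2}(cat_take_drop i s) count_cat leq_addr. Qed.

(* The number of labels 1 below [j] obeys the recursion of the length of the
   longest increasing subsequence with values below [j]. *)
Lemma count1_take_ins x v j : slot x v ->
  count_mem 1 (take j (ins x v)) =
  if x < j then maxn (count_mem 1 (take j v)) (count_mem 1 (take x v)).+1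
  else count_mem 1 (take j v).
Proof.
move=> hs; move: x v hs j; apply: slot_ind => [u|y u b hs IH] j.
  rewrite ins_last !take_rcons_le leqnn take_size.
  by case: leqP => // h; rewrite !count_mem_rcons; lia.
rewrite ins_rcons // !take_rcons_le size_ins // (ltnW (slot_lt hs)).
case: (leqP j (size u)) => [_|hj]; first exact: IH.
rewrite (ltn_trans (slot_lt hs) hj).
have := IH (size u); rewrite take_size slot_lt //.
rewrite -{1}(size_ins hs) take_size count_ins // !count_mem_rcons count_ins //.
have := lab_gt0 hs; have := count_take_le 1 y u.
by case: (b =P lab y u) => [->|]; lia.
Qed.

(** The row bumping lemma. A new largest value moves each of the two labels by at most one, and by
    the local rule it never changes their comparison. *)
Lemma lab_ins_le x y v : slot x v -> slot y (ins x v) ->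
  (lab y (ins x v) <= lab x v) = (x < y).
Proof.
move=> hs; move: x v hs y; apply: slot_ind => [u|x u b hs IH] y.
  rewrite ins_last lab_last slot_rcons andbF orbF => hy.
  rewrite lab_rcons // (ltnNge (size u)) (ltnW (slot_lt hy)) /=.
  by have := lab_gt0 hy; case: eqP; lia.
rewrite ins_rcons // slot_rcons size_ins // (lab_rcons _ hs).
have l0 := lab_gt0 hs.
case/orP=> [hy|/andP[/eqP->]].
  rewrite lab_rcons // -IH //; move: (lab y _) (lab x u) => p q.
  by case: (b =P q) => [->|]; case: eqP; lia.
have hx := slot_lt hs.
case: (b =P lab x u) => [//|_] /eqP->.
by rewrite -{1}(size_ins hs) lab_last; lia.
Qed.

(** Comparing the last letter with the label undoes the local rule: both are [1] if the largest
    value was inserted, equal and at least [2] if it was pushed down, different if it stayed in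
    place. *)
Lemma ins_inj x x' v v' : slot x v -> slot x' v' ->
  ins x v = ins x' v' -> lab x v = lab x' v' -> x = x' /\ v = v'.
Proof.
move=> hs; move: x v hs x' v'; apply: slot_ind => [u|x u b hs IH] x' v'.
  move=> hs'; move: x' v' hs' u; apply: slot_ind => [u'|x' u' b' hs' _] u.
    by rewrite !ins_last => /rcons_inj[->].
  rewrite ins_last lab_last ins_rcons // lab_rcons // => /rcons_inj[_].
  by have := lab_gt0 hs'; case: eqP; lia.
move=> hs'; move: x' v' hs' IH; apply: slot_ind => [u'|x' u' b' hs' _] IH.
  rewrite ins_last lab_last ins_rcons // lab_rcons // => /rcons_inj[_].
  by have := lab_gt0 hs; case: eqP; lia.
rewrite !ins_rcons // !lab_rcons // => /rcons_inj[e1 e2] e3.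
have [eb el] : b = b' /\ lab x u = lab x' u'.
  by move: e2 e3; do 2![case: eqP]; lia.
by have [-> ->] := IH _ _ hs' e1 el; rewrite eb.
Qed.

(* Reading the word from the right, an occurrence of the current label [r]
   must have come from the previous row, or be the inserted entry if [r = 1]. *)
Lemma ins_surj v r : lattice v -> count_mem r.+2 v < count_mem r.+1 v ->
  exists x v', [/\ slot x v', lattice v', ins x v' = v & lab x v' = r.+1].
Proof.
elim/last_ind: v r => [//|v b IH] r /lattice_rcons[hv hb] hr.
case: (b =P r.+1) => [eb|nb].
  case: r eb hr => [|r] eb hr.
    exists (size v), (rcons v 0); rewrite slot_rcons !eqxx orbT ins_last lab_last eb.
    split=> //; apply/lattice_rcons; split=> // r.
    by have := lattice_count r hv; rewrite !count_mem_rcons; lia.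
  have hr' : count_mem r.+2 v < count_mem r.+1 v.
    by have := hb r; rewrite !count_mem_rcons; lia.
  have [x [v' [h1 h2 h3 h4]]] := IH _ hv hr'.
  exists x, (rcons v' r.+1); rewrite slot_rcons h1 ins_rcons // lab_rcons // h3 h4 eqxx -eb.
  split=> //; apply/lattice_rcons; split=> // q.
  have := lattice_count q hv; rewrite -h3 !count_ins // h4 !count_mem_rcons.
  by lia.
have hr' : count_mem r.+2 v < count_mem r.+1 v.
  by move: hr; rewrite !count_mem_rcons; lia.
have [x [v' [h1 h2 h3 h4]]] := IH _ hv hr'.
exists x, (rcons v' b); rewrite slot_rcons h1 ins_rcons // lab_rcons // h3 h4.
case: (b =P r.+1) => // _.
split=> //; apply/lattice_rcons; split=> // q.
have := hb q; have := lattice_count q h2; move: hr.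
rewrite -h3 !count_mem_rcons !count_ins // h4.
by case: (q =P r) => [->|]; lia.
Qed.

(** * The RSK correspondence: inverse, ascents and increasing subsequences *)

Definition rsk (N : nat) (w : seq nat) : seq nat * seq nat :=
  foldl (fun PQ x => (ins x PQ.1, rcons PQ.2 (lab x PQ.1))) (nseq N 0, [::]) w.

Definition word_on (N : nat) (w : seq nat) : bool := uniq w && all (gtn N) w.

Lemma rsk_rcons N w x :
  rsk N (rcons w x) =
  (ins x (rsk N w).1, rcons (rsk N w).2 (lab x (rsk N w).1)).
Proof. by rewrite /rsk foldl_rcons. Qed.

Lemma word_on_rcons N w x :
  word_on N (rcons w x) = [&& x \notin w, x < N & word_on N w].
Proof.
rewrite /word_on rcons_uniq all_rcons /=.
by case: (x \in w) => //=; case: (x < N); rewrite ?andbF.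
Qed.

Lemma slot_nseq N j : slot j (nseq N 0) = (j < N).
Proof. by rewrite /slot nth_nseq; case: ifP. Qed.

Lemma slot_rsk N w j : word_on N w ->
  slot j (rsk N w).1 = (j < N) && (j \notin w).
Proof.
elim/last_ind: w j => [|w x IH] j; first by rewrite slot_nseq andbT.
rewrite word_on_rcons => /and3P[xw xN ww]; rewrite rsk_rcons /=.
rewrite slot_ins !IH ?xN ?xw //.
by rewrite mem_rcons in_cons negb_or -andbA [_ && (j != x)]andbC.
Qed.

Lemma slot_rsk_last N w x : word_on N (rcons w x) -> slot x (rsk N w).1.
Proof. by rewrite word_on_rcons => /and3P[xw xN ww]; rewrite slot_rsk // xN. Qed.

Lemma word_on_belast N w x : word_on N (rcons w x) -> word_on N w.
Proof. by rewrite word_on_rcons => /and3P[]. Qed.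

Lemma size_rsk1 N w : word_on N w -> size (rsk N w).1 = N.
Proof.
elim/last_ind: w => [|w x IH] hw; first by rewrite size_nseq.
by rewrite rsk_rcons size_ins ?slot_rsk_last // IH // (word_on_belast hw).
Qed.

Lemma size_rsk2 N w : size (rsk N w).2 = size w.
Proof.
by elim/last_ind: w => [|w x IH] //; rewrite rsk_rcons !size_rcons IH.
Qed.

Lemma count_rsk N w r : word_on N w ->
  count_mem r.+1 (rsk N w).1 = count_mem r.+1 (rsk N w).2.
Proof.
elim/last_ind: w => [|w x IH] hw; first by rewrite /rsk /= count_nseq.
rewrite rsk_rcons /= count_ins ?slot_rsk_last // IH ?(word_on_belast hw) //.
by rewrite count_mem_rcons.
Qed.

Lemma lattice_nseq0 N : lattice (nseq N 0).
Proof. by move=> i r; apply: leq_trans (count_take_le _ _ _) _; rewrite count_nseq. Qed.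

Lemma lattice_rsk1 N w : word_on N w -> lattice (rsk N w).1.
Proof.
elim/last_ind: w => [|w x IH] hw; first exact: lattice_nseq0.
by rewrite rsk_rcons; apply: lattice_ins (slot_rsk_last hw) (IH (word_on_belast hw)).
Qed.

Lemma lattice_rsk2 N w : word_on N w -> lattice (rsk N w).2.
Proof.
elim/last_ind: w => [//|w x IH] hw.
rewrite rsk_rcons lattice_rcons; split; first exact/IH/(word_on_belast hw).
move=> r; have := lattice_count r (lattice_rsk1 hw).
by rewrite !count_rsk // rsk_rcons.
Qed.

Lemma rsk2_gt0 N w : word_on N w -> 0 \notin (rsk N w).2.
Proof.
elim/last_ind: w => [//|w x IH] hw.
rewrite rsk_rcons mem_rcons in_cons negb_or IH ?(word_on_belast hw) // andbT.
by have := lab_gt0 (slot_rsk_last hw); lia.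
Qed.

Lemma rsk_inj N w w' : word_on N w -> word_on N w' -> rsk N w = rsk N w' -> w = w'.
Proof.
elim/last_ind: w w' => [|w x IH] w' hw hw' e.
  by have := size_rsk2 N w'; rewrite -e; case: w' {hw' e}.
case/lastP: w' hw' e => [|w' x'] hw' e.
  by have := size_rsk2 N (rcons w x); rewrite e size_rcons.
move: e; rewrite !rsk_rcons => -[e1 /rcons_inj[e2 e3]].
have [ex ev] := ins_inj (slot_rsk_last hw) (slot_rsk_last hw') e1 e3.
rewrite ex (IH w') ?(word_on_belast hw) ?(word_on_belast hw') //.
by rewrite [LHS]surjective_pairing [RHS]surjective_pairing ev e2.
Qed.

(** The last letter of [Q] names a corner of the common shape, from which [ins_surj] runs one
    insertion backwards. *)
Lemma rsk_surj P Q : lattice P -> lattice Q -> 0 \notin Q ->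
  (forall r, count_mem r.+1 P = count_mem r.+1 Q) ->
  exists2 w, word_on (size P) w & rsk (size P) w = (P, Q).
Proof.
elim/last_ind: Q P => [|Q q IH] P hP hQ h0 hc.
  exists [::] => //; rewrite /rsk /=; congr pair; apply/esym/all_pred1P/allP => b.
  case: b => // b hb; have := hc b; rewrite /= => /eqP.
  by rewrite -leqn0 leqNgt -has_count has_pred1 hb.
move: h0; rewrite mem_rcons in_cons negb_or; case: q hQ hc => // q hQ hc /= h0.
case/lattice_rcons: hQ => hQ hq.
have := lattice_count q hQ => hQ'.
have hr : count_mem q.+2 P < count_mem q.+1 P.
  by rewrite !hc !count_mem_rcons; lia.
have [x [v [h1 h2 h3 h4]]] := ins_surj hP hr.
have hc' r : count_mem r.+1 v = count_mem r.+1 Q.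
  by have := hc r; rewrite -h3 count_ins // h4 count_mem_rcons => /addIn.
have [w hw e] := IH v h2 hQ h0 hc'.
have es : size P = size v by rewrite -h3 size_ins.
exists (rcons w x).
  by rewrite es word_on_rcons hw andbT andbC -slot_rsk // e.
by rewrite es rsk_rcons e /= h3 h4.
Qed.

(** The row bumping lemma for two consecutive insertions: ascents of the word can be read off the
    recording word. *)
Lemma rsk_asc N w p : word_on N w -> p.+1 < size w ->
  (nth 0 (rsk N w).2 p.+1 <= nth 0 (rsk N w).2 p) = (nth 0 w p < nth 0 w p.+1).
Proof.
elim/last_ind: w => [//|w y IH] hw; rewrite size_rcons ltnS rsk_rcons /= => hp.
rewrite !nth_rcons size_rsk2 hp.
have hw1 := word_on_belast hw.
case: (ltngtP p.+1 (size w)) hp => // [hp _|hp _]; first exact: IH.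
case/lastP: w hp hw hw1 {IH} => [//|w x]; rewrite size_rcons => -[->] hw hw1.
rewrite rsk_rcons /= !nth_rcons size_rsk2 ltnn eqxx.
have := slot_rsk_last hw; rewrite rsk_rcons => h.
by rewrite lab_ins_le // slot_rsk_last.
Qed.

Lemma sorted_rcons_lt (s : seq nat) x :
  sorted ltn (rcons s x) = sorted ltn s && all (gtn x) s.
Proof.
rewrite -[LHS](@rev_sorted _ gtn) rev_rcons /= path_sortedE; last by move=> a b c /=; lia.
by rewrite all_rev rev_sorted andbC.
Qed.

(** Schensted's theorem on the first row. The bound [j] makes the induction work: a subsequence
    ending in [x] extends one with values below [x]. *)
Lemma rsk_lis N w j m : word_on N w ->
  m <= count_mem 1 (take j (rsk N w).1) <->
  exists s, [/\ subseq s w, sorted ltn s, all (gtn j) s & size s = m].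
Proof.
elim/last_ind: w j m => [|w x IH] j m hw.
  have -> : count_mem 1 (take j (rsk N [::]).1) = 0.
    apply/eqP; rewrite -leqn0; apply: leq_trans (count_take_le _ _ _) _.
    by rewrite /rsk /= count_nseq.
  rewrite leqn0; split=> [/eqP->|]; first by exists [::].
  by move=> [s [/eqP-> _ _ <-]].
have hs := slot_rsk_last hw; have hw1 := word_on_belast hw.
rewrite rsk_rcons /= count1_take_ins //.
have sub s : subseq s w -> subseq s (rcons w x).
  by move=> h; apply: subseq_trans h (subseq_rcons _ _).
split.
- have old : m <= count_mem 1 (take j (rsk N w).1) ->
    exists s, [/\ subseq s (rcons w x), sorted ltn s, all (gtn j) s & size s = m].
    by move=> /(IH _ _ hw1)[s [h1 h2 h3 h4]]; exists s; split=> //; apply: sub.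
  case: ifP => // xj; rewrite leq_max => /orP[//|].
  case: m old => [|m] old hm; first by apply: old.
  have [s [h1 h2 h3 h4]] := (IH _ _ hw1).1 hm.
  exists (rcons s x); split.
  + by rewrite -!cats1 cat_subseq.
  + by rewrite sorted_rcons_lt h2.
  + rewrite all_rcons /= xj; apply: sub_all h3 => a /=; lia.
  + by rewrite size_rcons h4.
- move=> [s [h1 h2 h3 h4]].
  (* The subsequence either omits the last letter [x] or ends in it, after smaller values. *)
  suff : m <= count_mem 1 (take j (rsk N w).1) \/
         x < j /\ m <= (count_mem 1 (take x (rsk N w).1)).+1.
    by case: ltnP; lia.
  case/lastP: s h1 h2 h3 h4 => [|s y] h1 h2 h3 <-; first by left.
  move: h1; rewrite -subseq_rev !rev_rcons /=.
  case: eqP => [exy|_]; rewrite ?subseq_rev => h1.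
    right; move: h2 h3; rewrite sorted_rcons_lt all_rcons -exy => /andP[h2 hx] /andP[yj _].
    by split=> //; rewrite size_rcons ltnS; apply/(IH _ _ hw1); exists s.
  by left; apply/(IH _ _ hw1); exists (rcons s y); split=> //; rewrite -subseq_rev rev_rcons.
Qed.

(** * Recording words and complementary fillings of the rectangle *)

Lemma sum_count_mem (M : nat) (s : seq nat) : 0 \notin s -> all (geq M) s ->
  \sum_(r < M) count_mem r.+1 s = size s.
Proof.
elim: s => [|x s IH] /=; first by move=> _ _; rewrite big1.
rewrite in_cons negb_or => /andP[x0 h0] /andP[xM hM].
rewrite big_split /= IH // -add1n; congr addn.
case: x x0 xM => // x _ xM; rewrite (bigD1 (Ordinal xM)) //= eqxx big1 // => i.
by rewrite -val_eqE /= => /negPf h; rewrite eqSS eq_sym h.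
Qed.

Lemma sum_defect1 (M : nat) (f g : nat -> nat) : (forall r, f r <= g r) ->
  \sum_(r < M) g r = (\sum_(r < M) f r).+1 ->
  exists2 d, d < M & forall r, r < M -> f r + (d == r) = g r.
Proof.
move=> fg h.
have /sum_nat_eq1[d [_ d1 d0]] : \sum_(r < M) (g r - f r) == 1.
  by rewrite sumnB // h subSnn.
exists d => // r rM; have := fg r; have := d0 (Ordinal rM); rewrite -val_eqE /=.
by case: (_ =P r :> nat) => [<-|hd]; [have := d1 | move=> h0; have {h0} := h0 _ isT]; lia.
Qed.

Lemma sorted_geq_split (r : nat) (b : seq nat) : sorted geq b ->
  b = filter (ltn r) b ++ filter (geq r) b.
Proof.
elim: b => //= x b IH hp; rewrite {1}IH ?(path_sorted hp) //.
move: hp; rewrite path_sortedE => [/andP[hx _]|]; last by move=> p q s /=; lia.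
case: (ltnP r x) => //= hr.
suff -> : [seq y <- b | r < y] = [::] by [].
apply/eqP; rewrite -[_ == _]negbK -has_filter; apply/hasPn => y /(allP hx) /=; lia.
Qed.

Lemma sorted_geq_count_inj (b b' : seq nat) : sorted geq b -> sorted geq b' ->
  (forall r, count_mem r b = count_mem r b') -> b = b'.
Proof.
move=> h h' e; apply: (@sorted_eq _ geq) => //.
- by move=> p q s /=; lia.
- by move=> p q /=; lia.
- by apply/allP => x _ /=; rewrite e.
Qed.

Lemma count_mem_map_succ r (s : seq nat) :
  count_mem r.+1 (map succn s) = count_mem r s.
Proof. by rewrite count_map; apply: eq_count => x. Qed.

(** The canonical weakly decreasing word with given letter counts; it records a strip filled from
    its bottom row upwards. *)
Fixpoint descending (f : nat -> nat) (M : nat) : seq nat :=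
  if M is M'.+1 then nseq (f M') M ++ descending f M' else [::].

Lemma descending_le f M : all (geq M) (descending f M).
Proof.
elim: M => //= M IH; rewrite all_cat all_nseq /= leqnn orbT /=.
by apply: sub_all IH => x /=; lia.
Qed.

Lemma descending_gt0 f M : 0 \notin descending f M.
Proof. by elim: M => //= M IH; rewrite mem_cat negb_or IH mem_nseq andbF. Qed.

Lemma sorted_descending f M : sorted geq (descending f M).
Proof.
elim: M => //= M IH; have := descending_le f M.
elim: (f M) => //= m IHm h; rewrite path_sortedE; last by move=> p q s /=; lia.
rewrite IHm // andbT all_cat all_nseq /= leqnn orbT /=.
by apply: sub_all h => x /=; lia.
Qed.

Lemma count_descending f M r :
  count_mem r.+1 (descending f M) = if r < M then f r else 0.
Proof.
elim: M => //= M IH; rewrite count_cat count_nseq /= IH eqSS.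
case: (ltngtP r M) => h; rewrite /= ?mul0n // ltnS ?(ltnW h) // -?h ?leqnn ?mul1n ?addn0 //.
by case: ltnP => //; lia.
Qed.

(* The shape of [u] pushed down by one row of length [k.+1]. *)
Definition shifted (k : nat) (u : seq nat) (r : nat) : nat :=
  if r is q.+1 then count_mem q.+1 u else k.+1.

Lemma sum_shifted k M u : 0 \notin u -> all (geq M) u ->
  \sum_(r < M.+1) shifted k u r = k.+1 + size u.
Proof. by move=> h0 hM; rewrite big_ord_recl /= -(sum_count_mem h0 hM). Qed.

Lemma all_geq_bound (s : seq nat) : exists M, all (geq M) s.
Proof.
exists (sumn s); apply/allP => x /=; elim: s => //= y s IH.
by rewrite in_cons => /predU1P[->|/IH]; lia.
Qed.

Lemma count_mem_bound M s r : all (geq M) s -> M <= r -> count_mem r.+1 s = 0.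
Proof.
move=> /allP h hr; apply/count_memPn; apply/negP => /h /=; lia.
Qed.

(* The [k] boxes of a weakly decreasing block form a horizontal strip, so the
   new shape lies inside the shifted one, which has exactly one box more. *)
Lemma block_defect k u b : lattice (u ++ b) -> 0 \notin u ++ b ->
  sorted geq b -> size b = k -> count_mem 1 (u ++ b) <= k.+1 ->
  exists2 d, 0 < d &
    forall r, count_mem r.+1 (u ++ b) + (d == r.+1) = shifted k u r.
Proof.
move=> hl h0 hs hk h1.
have hle r : count_mem r.+1 (u ++ b) <= shifted k u r.
  case: r => //= r; have /lattice_cat[_ h] := hl.
  (* The letters of [b] above [r.+1] come first. Just after them, row [r.+2] has its final length
     while row [r.+1] still has its old one. *)
  have := h (size (filter (ltn r.+1) b)) r.
  rewrite {2 4}(sorted_geq_split r.+1 hs) take_size_cat //.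
  have -> : count_mem r.+1 (filter (ltn r.+1) b) = 0.
    by apply/count_memPn; rewrite mem_filter /= ltnn.
  have -> : count_mem r.+2 (filter (ltn r.+1) b) = count_mem r.+2 b.
    by rewrite count_filter; apply: eq_count => x /=; lia.
  by rewrite count_cat addn0.
have [M hM] := all_geq_bound (u ++ b).
have hM' : all (geq M.+1) (u ++ b) by apply: sub_all hM => x /=; lia.
have hu : all (geq M) u by move: hM; rewrite all_cat => /andP[].
have hu0 : 0 \notin u by move: h0; rewrite mem_cat negb_or => /andP[].
have [|d dM hd] := @sum_defect1 M.+1 _ _ hle.
  by rewrite sum_shifted // sum_count_mem // size_cat hk addSn addnC.
exists d.+1 => // r; rewrite eqSS; case: (ltnP r M.+1) => hr; first exact: hd.
rewrite (count_mem_bound hM') //; case: r hr => //= r hr.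
by rewrite (count_mem_bound hu) //; lia.
Qed.

(** Converse of [block_defect]. Since [c] lies inside the shifted shape, even the final length of a
    row is at most the old length of the row above, so the lattice condition holds throughout the
    block. *)
Lemma block_of_defect k u (c : nat -> nat) d : lattice u -> 0 \notin u ->
  count_mem 1 u <= k.+1 -> (forall r, c r.+1 <= c r) -> 0 < d ->
  (forall r, c r + (d == r.+1) = shifted k u r) ->
  exists b, [/\ sorted geq b, size b = k, 0 \notin b, lattice (u ++ b) &
    forall r, count_mem r.+1 (u ++ b) = c r].
Proof.
move=> hl h0 h1 hc d0 hd.
(* In the row of the missing box, [d = r.+1], the bound comes from the next row: [c r] is at least
   [c r.+1], which is [count_mem r.+1 u]. *)
have cu r : count_mem r.+1 u <= c r.
  have := hd r.+1; have := hd r; have := hc r => /=; case: r => [|r] /=.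
    by move: h1; case: (d =P 1) => [->|_] /=; case: (d =P 2) => [_|_] /=; lia.
  have := lattice_count r hl.
  by case: (d =P r.+2) => [->|_] /=; case: (_ =P r.+3) => /=; lia.
have [M hM] := all_geq_bound u.
have cM r : M < r -> c r = 0.
  by case: r => // r hr; have := hd r.+1; rewrite /= (count_mem_bound hM) //; lia.
pose b := descending (fun r => c r - count_mem r.+1 u) M.+1.
have hb r : count_mem r.+1 (u ++ b) = c r.
  rewrite count_cat count_descending; case: ltnP => hr; first exact: subnKC.
  by rewrite (cM r) // (count_mem_bound hM) //; lia.
have b0 : 0 \notin b := descending_gt0 _ _.
have ub0 : 0 \notin u ++ b by rewrite mem_cat negb_or h0.
have ubM : all (geq M.+1) (u ++ b).
  by rewrite all_cat descending_le andbT; apply: sub_all hM => x /=; lia.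
(* Beyond row [M.+1] the shifted shape is empty and has no box to spare. *)
have hdM : d <= M.+1.
  case: leqP => // hM'; have := hd d.-1; rewrite prednK // eqxx.
  case: d {hd} d0 hM' => // [[|d]] //= _ hM'.
  by rewrite (count_mem_bound hM); lia.
exists b; split=> //; first exact: sorted_descending.
  have := sum_count_mem ub0 ubM; rewrite size_cat.
  under eq_bigr => r _ do rewrite hb.
  have := sum_shifted k h0 hM.
  rewrite -(eq_bigr _ (fun (r : 'I_M.+1) _ => hd r)) big_split /=.
  have -> : \sum_(i < M.+1) (d == i.+1) = 1.
    case: d d0 hdM {hd} => // d _ hdM; rewrite (bigD1 (Ordinal hdM)) //= eqxx big1 //.
    by move=> i; rewrite -val_eqE /= => /negPf h; rewrite eqSS eq_sym h.
  lia.
apply/lattice_cat; split=> // i r.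
have := hb r.+1; rewrite count_cat => e.
have /= := hd r.+1; have := count_take_le r.+2 i b; by move: e; case: (d == _) => /=; lia.
Qed.

(** With positions numbered from 0, [p] and [p.+1] share a block exactly when [k] does not divide
    [p.+1]. *)
Definition blockwise (R : rel nat) (k : nat) (s : seq nat) : Prop :=
  forall p, p.+1 < size s -> ~~ (k %| p.+1) -> R (nth 0 s p) (nth 0 s p.+1).

Lemma blockwise_cat R k n u b : size u = n * k -> size b = k ->
  blockwise R k (u ++ b) <-> blockwise R k u /\ sorted R b.
Proof.
move=> hu hb; split=> [h|[h1 h2] p].
  split=> [p hp hd|].
    have := h p _ hd; rewrite size_cat !nth_cat hp (ltnW hp); apply.
    exact: ltn_addr.
  apply/(sortedP 0) => i hi.
  have := h (size u + i); rewrite size_cat -addnS ltn_add2l hi => /(_ isT).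
  rewrite !nth_cat !ltnNge !leq_addr /= !addKn; apply.
  by rewrite hu dvdn_addr ?dvdn_mull // gtnNdvd // -hb.
rewrite size_cat => hp hd; rewrite !nth_cat.
case: (ltngtP p.+1 (size u)) => hpu.
- exact: h1.
- rewrite subSn //.
  by move/(sortedP 0): h2; apply; lia.
- by move: hd; rewrite hpu hu dvdn_mull.
Qed.

(** Weakly decreasing blocks are horizontal strips, and the letters [1] count the first row, hence
    the longest increasing subsequence of the permutation. *)
Definition recording_word (n k : nat) (u : seq nat) : Prop :=
  [/\ lattice u, 0 \notin u, size u = n * k, blockwise geq k u &
      count_mem 1 u <= k.+1].

(* [t] lists the rows in which the shape [c] is filled up, box by box, to the
   [n] by [k.+1] rectangle. *)
Definition fills_up (n k : nat) (c : nat -> nat) (t : seq nat) : Prop :=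
  [/\ size t = n, 0 \notin t,
      forall i r, c r.+1 + count_mem r.+2 (take i t) <=
                  c r + count_mem r.+1 (take i t) &
      forall r, c r + count_mem r.+1 t = if r < n then k.+1 else 0].

(** The last block of [u] yields the first letter of [t], the row of its missing box. The other
    letters come from [u'], whose shape is pushed down one row, hence [map succn]. *)
Fixpoint complementary (k n : nat) (u t : seq nat) : Prop :=
  if n is n'.+1 then
    exists u' b d t',
      [/\ u = u' ++ b, size b = k /\ sorted geq b, t = d :: map succn t',
          complementary k n' u' t' &
          [/\ 0 < d, 0 \notin b &
              forall r, count_mem r.+1 u + (d == r.+1) = shifted k u' r]]
  else u = [::] /\ t = [::].

Lemma complementary_fun k n u t t' :
  complementary k n u t -> complementary k n u t' -> t = t'.
Proof.
elim: n u t t' => [|n IH] u t t' /=; first by move=> [_ ->] [_ ->].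
move=> [u1 [b1 [d1 [t1 [e1 [hb1 _] -> h1 [p1 _ c1]]]]]].
move=> [u2 [b2 [d2 [t2 [e2 [hb2 _] -> h2 [p2 _ c2]]]]]].
have eu : u1 = u2.
  have es : size u1 = size u2.
    by have := congr1 size e1; rewrite e2 !size_cat hb1 hb2 => /addIn.
  by have /eqP := e2; rewrite e1 eqseq_cat // => /andP[/eqP].
subst u2; rewrite (IH _ _ _ h1 h2); congr cons.
(* The equations for [d1] and [d2] have equal right sides, so their extra boxes agree in row
   [d1]. *)
have := c1 d1.-1; rewrite -c2 prednK // eqxx; by case: eqP; lia.
Qed.

(** The shape and the first letter of [t] give the shape before the last block, so induction
    applies; the last block is then a weakly decreasing word with known letter counts. *)
Lemma complementary_inj k n u u' t :
  complementary k n u t -> complementary k n u' t ->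
  (forall r, count_mem r.+1 u = count_mem r.+1 u') -> u = u'.
Proof.
elim: n u u' t => [|n IH] u u' t /=; first by move=> [-> _] [-> _].
move=> [u1 [b1 [d1 [t1 [e1 [_ s1] -> h1 [p1 z1 c1]]]]]].
move=> [u2 [b2 [d2 [t2 [e2 [_ s2] [ed et] h2 [p2 z2 c2]]]]]] e.
have {}et : t1 = t2 by apply: inj_map et => ? ? [].
subst t2 d2.
have eu : u1 = u2.
  by apply: IH h1 h2 _ => r; have := c1 r.+1; rewrite e c2.
rewrite e1 e2 eu; congr cat; apply: sorted_geq_count_inj => // -[|r].
  by rewrite (count_memPn z1) (count_memPn z2).
by have := e r; rewrite e1 e2 eu !count_cat => /addnI.
Qed.

(** Adding the box in row [d] leaves a full first row on top of the shape of [u']. The filling for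
    [u'], moved down one row, completes the rectangle. *)
Lemma recording_word_fills_up n k u : recording_word n k u ->
  exists2 t, fills_up n k (fun r => count_mem r.+1 u) t & complementary k n u t.
Proof.
elim: n u => [|n IH] u [hl h0 hsz hb h1].
  by case: u hsz {hl h0 hb h1} => // _; exists [::].
have [u' [b [eu su sb]]] : exists u' b, [/\ u = u' ++ b, size u' = n * k & size b = k].
  exists (take (n * k) u), (drop (n * k) u); rewrite cat_take_drop; split=> //.
    by rewrite size_takel // hsz leq_mul2r leqnSn orbT.
  by rewrite size_drop hsz mulSn addnK.
rewrite eu in hl h0 hb h1 *.
have /(blockwise_cat _ su sb)[hbu hbb] := hb.
have [d d0 hd] := block_defect hl h0 hbb sb h1.
have [hlu _] := (lattice_cat _ _).1 hl.
have [hu0 hb0] : 0 \notin u' /\ 0 \notin b.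
  by apply/andP; rewrite -negb_or -mem_cat.
have [|t [t1 t2 t3 t4] ht] := IH u'.
  by split=> //; apply: leq_trans h1; rewrite count_cat leq_addr.
(* Once moved down, this row must stay within the full first row above it. *)
have k1 i : count_mem 1 u' + count_mem 1 (take i t) <= k.+1.
  apply: leq_trans (_ : count_mem 1 u' + count_mem 1 t <= _).
    by rewrite leq_add2l count_take_le.
  by rewrite t4; case: ifP.
exists (d :: map succn t); last by exists u', b, d, t.
split=> [||i r|r].
- by rewrite /= size_map t1.
- by rewrite in_cons negb_or eq_sym -lt0n d0; apply/mapP => -[].
- case: i => [|i]; first by rewrite /= !addn0; apply: lattice_count.
  rewrite /= -map_take !addnA !hd !count_mem_map_succ.
  case: r => [|r]; last exact: t3.
  exact: leq_trans (k1 i) (leq_addr _ _).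
- rewrite /= addnA hd count_mem_map_succ.
  case: r => [|r]; last exact: t4.
  by rewrite (count_memPn t2) addn0.
Qed.

(** The first letter of [t] fills the first row; induction applies to the rows below, and
    [block_of_defect] restores the last block. *)
Lemma fills_up_recording_word n k c t : fills_up n k c t ->
  exists u, [/\ recording_word n k u, complementary k n u t &
                forall r, count_mem r.+1 u = c r].
Proof.
elim: n c t => [|n IH] c t [t1 t2 t3 t4].
  by exists [::]; case: t t1 t4 {t2 t3} => //= _ t4; split=> // r; have := t4 r; lia.
case: t t1 t2 t3 t4 => // d t [t1]; rewrite in_cons negb_or eq_sym -lt0n => /andP[d0 t2] t3 t4.
(* The shape after the first letter of [t], meant to be the shifted shape of [u']. *)
pose e r := c r + (d == r.+1).
have he i r : e r.+1 + count_mem r.+2 (take i t) <= e r + count_mem r.+1 (take i t).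
  by have := t3 i.+1 r; rewrite /e /= !addnA.
have e_le r : e r <= e 0.
  by elim: r => // r IHr; have := he 0 r; rewrite take0 /=; lia.
have e_tot r : e r + count_mem r.+1 t = if r < n.+1 then k.+1 else 0.
  by rewrite -t4 /e /= addnA.
(* A first row that is not yet full forces all [n.+1] rows to occur in [t],
   which has only [n] letters. *)
have e0 : e 0 = k.+1.
  have := e_tot 0; case: (ltnP (e 0) k.+1) => [he0 _|]; last by rewrite ltnS leq0n; lia.
  suff /uniq_leq_size : {subset map succn (iota 0 n.+1) <= t}.
    by rewrite map_inj_uniq ?iota_uniq => [/(_ isT)|? ? []//]; rewrite size_map size_iota t1 ltnn.
  move=> x /mapP[r]; rewrite mem_iota add0n => /= hr ->.
  rewrite -has_pred1 has_count; have := e_tot r; rewrite hr; have := e_le r; lia.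
(* The first row is full already, so the rest of [t] can be moved up one row. *)
have t11 : 1 \notin t by apply/count_memPn; have := e_tot 0; rewrite e0 /=; lia.
have et : t = map succn (map predn t).
  rewrite -map_comp map_id_in // => x xt /=; rewrite prednK //.
  by case: x xt t2 => // ->.
have [|u' [hu hc eu]] := IH (fun r => e r.+1) (map predn t).
  split.
  - by rewrite size_map.
  - apply/mapP => -[x xt]; case: x xt => [h|[h|//]] _; first by rewrite h in t2.
    by rewrite h in t11.
  - move=> i r; rewrite -!(count_mem_map_succ _ (take _ _)) map_take -et; exact: he.
  - by move=> r; rewrite -(count_mem_map_succ _ (map _ _)) -et e_tot.
have [u1 u2 u3 u4 u5] := hu.
have hsh r : c r + (d == r.+1) = shifted k u' r.
  by case: r => [|r] /=; rewrite ?eu // -e0.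
have hcp r : c r.+1 <= c r by have := t3 0 r; rewrite take0 /= !addn0.
have [b [b1 b2 b3 b4 b5]] := block_of_defect u1 u2 u5 hcp d0 hsh.
exists (u' ++ b); split=> //.
  split=> //.
  - by rewrite mem_cat negb_or u2.
  - by rewrite size_cat u3 b2 mulSn addnC.
  - by apply/(blockwise_cat _ u3 b2).
  - by rewrite b5; have := hsh 0 => /=; lia.
exists u', b, d, (map predn t); split=> //; first by rewrite -et.
by split=> // r; rewrite b5.
Qed.

(** * Standard tableaux as lattice words *)

Lemma count_take_sum (a j : nat) (s : seq nat) :
  count_mem a (take j s) = \sum_(v < size s) ((v < j) && (nth 0 s v == a)).
Proof.
elim/last_ind: s => [|s b IH]; first by rewrite big_ord0.
rewrite size_rcons big_ord_recr /= nth_rcons ltnn eqxx take_rcons_le.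
transitivity (count_mem a (take j s) + ((size s < j) && (b == a))).
  case: leqP => h /=; first by rewrite addn0.
  by rewrite count_mem_rcons take_oversize // ltnW.
rewrite IH; congr addn; apply: eq_bigr => v _.
by rewrite nth_rcons ltn_ord.
Qed.

Lemma count_take_card (N a j : nat) (s : seq nat) : size s = N ->
  count_mem a (take j s) = #|[set v : 'I_N | (v < j) && (nth 0 s v == a)]|.
Proof.
move=> <-; rewrite count_take_sum -sum1dep_card [RHS]big_mkcond /=.
by apply: eq_bigr => v _; case: (_ && _).
Qed.

Lemma count_take_leq (a i j : nat) (s : seq nat) : i <= j ->
  count_mem a (take i s) <= count_mem a (take j s).
Proof. by move=> ij; rewrite -(minn_idPl ij) take_min count_take_le. Qed.

Lemma count_take_nth (a p : nat) (s : seq nat) : 0 < a -> nth 0 s p = a ->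
  count_mem a (take p.+1 s) = (count_mem a (take p s)).+1.
Proof.
move=> a0 e; rewrite (take_nth 0) ?count_mem_rcons ?e ?eqxx ?addn1 //.
by case: ltnP => // h; rewrite nth_default // in e; rewrite -e in a0.
Qed.

Lemma nth_occurrence_inj (a p p' : nat) (s : seq nat) : 0 < a ->
  nth 0 s p = a -> nth 0 s p' = a ->
  count_mem a (take p s) = count_mem a (take p' s) -> p = p'.
Proof.
wlog lt_pp' : p p' / p < p' => [H|] a0 e e' ec.
  by case: (ltngtP p p') => // h; [|apply/esym]; apply: H.
have := count_take_leq a s lt_pp'.
by rewrite (count_take_nth a0 e) ec ltnn.
Qed.

Lemma nth_occurrence (a q : nat) (s : seq nat) : q < count_mem a s ->
  exists p, [/\ p < size s, nth 0 s p = a & count_mem a (take p s) = q].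
Proof.
elim/last_ind: s => [//|s b IH]; rewrite count_mem_rcons => hq.
have [/IH[p [h1 h2 h3]]|hq'] := ltnP q (count_mem a s).
  exists p; rewrite size_rcons ltnW // nth_rcons h1; split=> //.
  by rewrite take_rcons_le (ltnW h1).
exists (size s); rewrite size_rcons nth_rcons ltnn eqxx take_rcons_le take_size.
move: hq; case: (b =P a) => [->|_]; last by rewrite addn0 ltnNge hq'.
by rewrite addn1 ltnS => hq; split=> //; rewrite leqnn; apply/eqP; rewrite eqn_leq hq hq'.
Qed.

Lemma lattice_leq (s : seq nat) i r r' : lattice s -> r <= r' ->
  count_mem r'.+1 (take i s) <= count_mem r.+1 (take i s).
Proof.
move=> hs; elim: r' => [|r' IH]; first by rewrite leqn0 => /eqP->.
rewrite leq_eqVlt => /predU1P[->//|h].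
exact: leq_trans (hs i r') (IH h).
Qed.

Section SytWords.

Variable la : seq nat.

Lemma cell_eq (c d : cell la) : row c = row d -> col c = col d -> c = d.
Proof.
case: c d => [i q] [i' q']; rewrite /row /col /= => /val_inj e; subst i'.
by move=> /val_inj->.
Qed.

Lemma ltn_col (c : cell la) : col c < nth 0 la (row c).
Proof. exact: ltn_ord. Qed.

Lemma cell_exists r q : q < nth 0 la r ->
  exists c : cell la, row c = r /\ col c = q.
Proof.
move=> hq; have hr : r < size la by case: ltnP => // h; rewrite nth_default in hq.
by exists (Tagged (fun i : 'I_(size la) => 'I_(nth 0 la i))
  (Ordinal hq : 'I_(nth 0 la (Ordinal hr)))).
Qed.

Lemma card_row_prefix r q : q <= nth 0 la r ->
  #|[set c : cell la | (row c == r) && (col c < q)]| = q.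
Proof.
move=> hq; rewrite cardE -[LHS](size_map (@col la)) -[RHS](size_iota 0).
apply/perm_size/uniq_perm; rewrite ?iota_uniq //.
  rewrite map_inj_in_uniq ?enum_uniq // => c d; rewrite !mem_enum !inE.
  by move=> /andP[/eqP hc _] /andP[/eqP hd _]; apply: cell_eq; rewrite hc hd.
move=> x; rewrite mem_iota /=; apply/mapP/idP => [[c]|hx].
  by rewrite mem_enum inE => /andP[_ h] ->.
have [c [rc cc]] := cell_exists (leq_trans hx hq).
by exists c => //; rewrite mem_enum inE rc eqxx cc.
Qed.

Definition yamanouchi (s : seq nat) : Prop :=
  [/\ size s = sumn la, lattice s, 0 \notin s &
      forall r, count_mem r.+1 s = nth 0 la r].

(* [T c] is the position in [s] of the occurrence number [col c] of the letter
   [(row c).+1], occurrences being numbered from 0. *)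
Definition row_word (s : seq nat) (T : filling la) : Prop :=
  forall c, nth 0 s (T c) = (row c).+1 /\
            count_mem (row c).+1 (take (T c) s) = col c.

Lemma row_word_fun s (T T' : filling la) : row_word s T -> row_word s T' -> T = T'.
Proof.
move=> h h'; apply/ffunP => c; apply: val_inj.
have [h1 h2] := h c; have [h1' h2'] := h' c.
by apply: nth_occurrence_inj h1 h1' _; rewrite // h2.
Qed.

Lemma syt_bij (T : filling la) : is_syt T -> bijective T.
Proof.
case/and3P => /forallP h _ _.
have /fin_all_exists[g hg] (v : 'I_(sumn la)) : exists c, forall d, (T d == v) = (d == c).
  have /cards1P[c e] := h v; exists c => d.
  by have := in_set1 d c; rewrite -e inE.
exists g => [c|v]; last by apply/eqP; rewrite hg.
by apply/esym/eqP; rewrite -hg.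
Qed.

Lemma row_word_inj s s' T : is_syt T -> size s = sumn la -> size s' = sumn la ->
  row_word s T -> row_word s' T -> s = s'.
Proof.
move=> /syt_bij[g _ gK] hs hs' h h'.
apply: (@eq_from_nth _ 0); rewrite hs ?hs' // => v hv.
by rewrite -[v]/(val (Ordinal hv)) -(gK (Ordinal hv)) (h _).1 (h' _).1.
Qed.

(** Position [v] receives the row of the cell holding [v]. As rows increase, earlier occurrences of
    a letter are the cells to the left. *)
Lemma row_word_of_syt (T : filling la) : sorted geq la -> is_syt T ->
  exists2 s, yamanouchi s & row_word s T.
Proof.
move=> hla hT; have [g gK Tg] := syt_bij hT.
have /and3P[_ /forallP hrow /forallP hcol] := hT.
have ltr c d : row c = row d -> col c < col d -> T c < T d.
  by move=> e1 e2; have /forallP/(_ d) := hrow c; rewrite e1 eqxx e2.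
have ltc c d : col c = col d -> row c < row d -> T c < T d.
  by move=> e1 e2; have /forallP/(_ d) := hcol c; rewrite e1 eqxx e2.
have ltrE c d : row c = row d -> (T c < T d) = (col c < col d).
  move=> e; apply/idP/idP; last exact: ltr.
  apply: contraLR; rewrite -!leqNgt leq_eqVlt => /predU1P[e'|/ltr/ltnW]; last exact.
  by rewrite (cell_eq e).
pose s := [seq (row (g v)).+1 | v <- enum 'I_(sumn la)].
have ss : size s = sumn la by rewrite size_map size_enum_ord.
have nths (v : 'I_(sumn la)) : nth 0 s v = (row (g v)).+1.
  by rewrite (nth_map v) ?nth_ord_enum // size_enum_ord.
have cnt a j : count_mem a.+1 (take j s) = #|[set c | (row c == a) && (T c < j)]|.
  rewrite (count_take_card _ _ ss).
  rewrite -(card_imset _ (can_inj gK)); apply: eq_card => v; rewrite inE nths eqSS.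
  apply/idP/imsetP => [/andP[vj /eqP e]|[c]].
    by exists (g v); rewrite ?inE ?e ?eqxx ?Tg.
  by rewrite inE => /andP[/eqP e h] ->; rewrite h gK e eqxx.
have tot a : count_mem a.+1 s = nth 0 la a.
  rewrite -{1}(take_size s) cnt ss -[RHS](card_row_prefix (leqnn _)).
  apply: eq_card => c; rewrite !inE ltn_ord andbT.
  by case: eqP => //= <-; rewrite ltn_col.
exists s.
  split=> //; last by apply/mapP => -[].
  (* The cell above a cell of row [r.+1] has a smaller entry, so the columns reached in row [r.+1]
     are also reached in row [r]. *)
  move=> i r; rewrite !cnt !cardE -2!(size_map (@col la)).
  apply: uniq_leq_size.
    rewrite map_inj_in_uniq ?enum_uniq // => c d; rewrite !mem_enum !inE.
    by move=> /andP[/eqP hc _] /andP[/eqP hd _]; apply: cell_eq; rewrite hc hd.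
  move=> x /mapP[c]; rewrite mem_enum inE => /andP[/eqP rc ci] ->.
  have hc : col c < nth 0 la r.
    apply: leq_trans (ltn_col c) _; rewrite rc.
    have [hr|hr] := ltnP r.+1 (size la); last by rewrite nth_default.
    by have /(sortedP 0)/(_ _ hr) := hla.
  have [d [rd cd]] := cell_exists hc.
  apply/mapP; exists d => //; rewrite mem_enum inE rd eqxx /=.
  by apply: ltn_trans ci; apply: ltc => //; rewrite rd rc.
move=> c; rewrite nths gK; split=> //; rewrite cnt.
rewrite -[RHS](card_row_prefix (ltnW (ltn_col c))); apply: eq_card => d; rewrite !inE.
by case: eqP => //= e; rewrite ltrE.
Qed.

Lemma row_word_is_syt s T : yamanouchi s -> row_word s T -> is_syt T.
Proof.
move=> [hs hl h0 hc] h.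
have Tinj : injective T.
  move=> c d e; have [c1 c2] := h c; have [d1 d2] := h d.
  have er : row c = row d by move: c1; rewrite e d1 => -[].
  by apply: cell_eq; rewrite // -c2 -d2 e er.
apply/and3P; split; apply/forallP.
- move=> v; have : nth 0 s v \in s by rewrite mem_nth // hs.
  case e: (nth 0 s v) => [|r] hv; first by rewrite hv in h0.
  have hq : count_mem r.+1 (take v s) < nth 0 la r.
    by rewrite -hc -(count_take_nth _ e) // count_take_le.
  have [c [rc cc]] := cell_exists hq.
  have [h1 h2] := h c; rewrite rc cc in h1 h2.
  have Tc : T c = v by apply: val_inj; apply: nth_occurrence_inj h1 e h2.
  apply/cards1P; exists c; apply/setP => d; rewrite !inE -Tc.
  by apply/eqP/eqP => [/Tinj|->].
- move=> c; apply/forallP => d; apply/implyP => /andP[/eqP er lt_cd].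
  rewrite ltnNge; apply/negP => /(count_take_leq (row c).+1 s).
  by rewrite (h c).2 er (h d).2 leqNgt lt_cd.
- move=> c; apply/forallP => d; apply/implyP => /andP[/eqP ec lt_cd].
  have ne : T c != T d :> nat.
    by apply/eqP => e; have := (h c).1; rewrite e (h d).1 => -[e']; rewrite e' ltnn in lt_cd.
  (* Otherwise the prefix through position [T d] would hold [(col d).+1] letters for [row d] but at
     most [col c] for [row c], against the lattice property. *)
  rewrite ltn_neqAle ne -ltnS ltnNge; apply/negP => /(count_take_leq (row c).+1 s).
  rewrite (h c).2 ec leqNgt.
  have := lattice_leq (T d).+1 hl (ltnW lt_cd).
  by rewrite (count_take_nth _ (h d).1) // (h d).2 => ->.
Qed.

Lemma row_word_exists s : yamanouchi s -> exists T : filling la, row_word s T.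
Proof.
move=> [hs _ _ hc].
have /fin_all_exists[T hT] (c : cell la) : exists v : 'I_(sumn la),
    nth 0 s v = (row c).+1 /\ count_mem (row c).+1 (take v s) = col c.
  have := ltn_col c; rewrite -hc => /nth_occurrence[p [hp h1 h2]].
  by rewrite hs in hp; exists (Ordinal hp).
by exists [ffun c => T c] => c; rewrite ffunE.
Qed.

End SytWords.

(** * From permutations to tableaux *)

Lemma subseq_iota (N : nat) (q : seq nat) :
  sorted ltn q -> all (gtn N) q -> subseq q (iota 0 N).
Proof.
move=> hq hN; suff -> : q = filter (mem q) (iota 0 N) by apply: filter_subseq.
apply: (irr_sorted_eq ltn_trans ltnn) => //.
  exact: (sorted_filter ltn_trans) (iota_ltn_sorted _ _).
move=> x; rewrite mem_filter mem_iota /= add0n.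
by case xq: (x \in q) => //=; have /allP/(_ _ xq) := hN.
Qed.

Lemma increasing_subseqP (s : seq nat) m :
  (exists s', [/\ subseq s' s, sorted ltn s' & size s' = m]) <->
  (exists q, [/\ sorted ltn q, all (gtn (size s)) q,
                 sorted ltn (map (nth 0 s) q) & size q = m]).
Proof.
have es : map (nth 0 s) (iota 0 (size s)) = s by rewrite -[RHS](mkseq_nth 0).
split=> [[s' [h1 h2 h3]]|[q [h1 h2 h3 h4]]].
  move: h1; rewrite -{1}es => /subseqP[msk hm e].
  rewrite -map_mask in e.
  exists (mask msk (iota 0 (size s))); rewrite -e; split=> //.
  - exact: (sorted_mask ltn_trans) (iota_ltn_sorted _ _).
  - by apply/allP => x /mem_mask; rewrite mem_iota.
  - by rewrite -h3 e size_map.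
exists (map (nth 0 s) q); split=> //; last by rewrite size_map.
by rewrite -{2}es; apply/map_subseq/subseq_iota.
Qed.

Section OneLine.

Variable N : nat.
Implicit Type w : 'S_N.

Definition one_line (w : 'S_N) : seq nat := [seq w i : nat | i <- enum 'I_N].

Lemma size_one_line w : size (one_line w) = N.
Proof. by rewrite size_map size_enum_ord. Qed.

Lemma nth_one_line w (i : 'I_N) : nth 0 (one_line w) i = w i.
Proof. by rewrite (nth_map i) ?nth_ord_enum // size_enum_ord. Qed.

Lemma one_line_word w : word_on N (one_line w).
Proof.
rewrite /word_on map_inj_uniq ?enum_uniq; last by move=> i j /val_inj/perm_inj.
by apply/allP => x /mapP[i _ ->]; apply: ltn_ord.
Qed.

Lemma one_line_inj w w' : one_line w = one_line w' -> w = w'.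
Proof. by move=> e; apply/permP => i; apply: val_inj; rewrite /= -!nth_one_line e. Qed.

Lemma one_line_surj s : word_on N s -> size s = N -> exists w, one_line w = s.
Proof.
move=> /andP[hu /allP ha] hs.
have /fin_all_exists[f hf] (i : 'I_N) : exists v : 'I_N, v = nth 0 s i :> nat.
  have hi : nth 0 s i < N by apply/ha/mem_nth; rewrite hs.
  by exists (Ordinal hi).
have f_inj : injective f.
  move=> i j e; apply/val_inj/eqP; rewrite /= -(nth_uniq 0 _ _ hu) ?hs //.
  by rewrite -!hf e.
exists (perm f_inj); apply: (@eq_from_nth _ 0); rewrite size_one_line // => i hi.
by rewrite -[i]/(val (Ordinal hi)) nth_one_line permE hf.
Qed.

Lemma mem_one_line w x : x < N -> x \in one_line w.
Proof.
move=> hx; apply/mapP; exists ((w^-1)%g (Ordinal hx)); first by rewrite mem_enum.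
by rewrite permKV.
Qed.

Lemma contains_id w m :
  contains (fun i => w i) (1%g : 'S_m) <->
  exists q, [/\ sorted ltn q, all (gtn N) q,
                sorted ltn (map (nth 0 (one_line w)) q) & size q = m].
Proof.
split=> [/existsP[f /andP[/forallP h1 /forallP h2]]|[q [h1 h2 h3 h4]]].
  have lt1 (a b : 'I_m) : a < b -> f a < f b.
    by move=> ab; have /forallP/(_ b) := h1 a; rewrite ab.
  have lt2 (a b : 'I_m) : a < b -> w (f a) < w (f b).
    by move=> ab; have /forallP/(_ b)/eqP-> := h2 a; rewrite !perm1.
  have nthf (g : 'I_m -> nat) i (hi : i < m) : nth 0 [seq g a | a <- enum 'I_m] i = g (Ordinal hi).
    by rewrite (nth_map (Ordinal hi)) ?size_enum_ord // -[i]/(val (Ordinal hi)) nth_ord_enum.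
  exists [seq f a : nat | a <- enum 'I_m]; split.
  - apply/(sortedP 0) => i; rewrite size_map size_enum_ord => hi.
    by rewrite !nthf ?(ltnW hi) // => hi'; apply: lt1.
  - by apply/allP => x /mapP[a _ ->]; apply: ltn_ord.
  - rewrite -map_comp; apply/(sortedP 0) => i; rewrite size_map size_enum_ord => hi.
    by rewrite !nthf ?(ltnW hi) // => hi' /=; rewrite !nth_one_line; apply: lt2.
  - by rewrite size_map size_enum_ord.
have /fin_all_exists[f hf] (a : 'I_m) : exists i : 'I_N, i = nth 0 q a :> nat.
  have ha : nth 0 q a < N by apply/(allP h2)/mem_nth; rewrite h4.
  by exists (Ordinal ha).
have lt1 (a b : 'I_m) : a < b -> f a < f b.
  by move=> ab; rewrite !hf; apply: (sorted_ltn_nth ltn_trans) => //; rewrite inE h4.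
have lt2 (a b : 'I_m) : a < b -> w (f a) < w (f b).
  move=> ab; rewrite -!nth_one_line !hf -!(nth_map _ 0 (nth 0 _)) ?h4 //.
  by apply: (sorted_ltn_nth ltn_trans) => //; rewrite inE size_map h4.
apply/existsP; exists [ffun a => f a]; apply/andP.
split; apply/forallP => a; apply/forallP => b; rewrite !ffunE.
  by apply/implyP/lt1.
rewrite !perm1; case: (ltngtP a b) => h; apply/eqP.
- exact: lt2.
- by apply/negbTE; rewrite -leqNgt ltnW // lt2.
- by rewrite (val_inj h) ltnn.
Qed.

(** Schensted's theorem with the bound [j = N], moved from the insertion word to the recording word,
    which has the same shape. *)
Lemma avoids_id w m :
  avoids (fun i => w i) (1%g : 'S_m.+1) =
  (count_mem 1 (rsk N (one_line w)).2 <= m).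
Proof.
have hw := one_line_word w.
rewrite /avoids leqNgt; congr negb; apply/idP/idP.
  move=> /contains_id hq; have /increasing_subseqP[s [h1 h2 h3]] : exists q,
    [/\ sorted ltn q, all (gtn (size (one_line w))) q,
        sorted ltn (map (nth 0 (one_line w)) q) & size q = m.+1].
    by rewrite size_one_line.
  rewrite -(count_rsk 0 hw) -(take_oversize (leqnn (size (rsk N (one_line w)).1))) size_rsk1 //.
  apply/rsk_lis => //; exists s; split=> //.
  by apply/allP => x /(mem_subseq h1); case/andP: hw => _ /allP; apply.
rewrite -(count_rsk 0 hw) -(take_oversize (leqnn (size (rsk N (one_line w)).1))) size_rsk1 //.
move=> /(rsk_lis _ _ hw)[s [h1 h2 _ h3]]; apply/contains_id.
have [|q hq] := (increasing_subseqP (one_line w) m.+1).1; first by exists s.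
by rewrite size_one_line in hq; exists q.
Qed.

End OneLine.

(** * Block conditions on permutations and on recording words *)

Lemma sorted_mkseq (R : rel nat) (g : nat -> nat) m :
  (forall x, x.+1 < m -> R (g x) (g x.+1)) -> sorted R (mkseq g m).
Proof.
move=> h; apply/(sortedP 0) => i; rewrite size_mkseq => hi.
by rewrite !nth_mkseq ?(ltnW hi) //; apply: h.
Qed.

Lemma L1_blockwise n k (w : 'S_(n * k)) :
  L1 w <-> blockwise ltn k (one_line w).
Proof.
split=> [/forallP h p|h].
  rewrite size_one_line => hp hd.
  have k0 : 0 < k by rewrite lt0n; apply: contraTneq hp => ->; rewrite muln0.
  have hi : p %/ k < n by rewrite ltn_divLR // ltnW.
  have hj : (p %% k).+1 < k.
    rewrite ltn_neqAle ltn_mod k0 andbT; apply: contraNneq hd => e.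
    by rewrite {1}(divn_eq p k) -addnS e -mulSnr dvdn_mull.
  have /forallP/(_ (Ordinal (ltnW hj)))/forallP/(_ (Ordinal hj)) := h (Ordinal hi).
  by rewrite eqxx /= /entry -!nth_one_line /= addnS -divn_eq.
apply/forallP => i; apply/forallP => j; apply/forallP => j'; apply/implyP => /eqP e.
rewrite /entry -!nth_one_line /= e addnS; apply: h.
  by rewrite size_one_line -addnS -e (ltn_ord (block_pos i j')).
by rewrite -addnS dvdn_addr ?dvdn_mull // gtnNdvd // -e.
Qed.

(* If [w_(i,j+1) < w_(i+1,j)], the first [j+1] entries of block [i] followed by
   block [i+1] from its [j]-th entry on form an increasing subsequence of
   length [k+2]. *)
Lemma L2_of_avoids n k (w : 'S_(n * k)) : L1 w ->
  avoids (fun i => w i) (1%g : 'S_k.+2) -> L2 w.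
Proof.
move=> /L1_blockwise hb hav.
apply/forallP => i; apply/forallP => i'; apply/forallP => j; apply/forallP => j'.
apply/implyP => /andP[/eqP ei /eqP ej]; rewrite ltnNge.
apply: contraNN hav => hle; apply/contains_id.
have hlt : entry w i j' < entry w i' j.
  rewrite ltn_neqAle hle andbT; apply/eqP => /val_inj/perm_inj/(congr1 val) /=.
  by have := ltn_ord j'; rewrite ei ej mulSn; lia.
have hj := ltn_ord j'; have hi := ltn_ord i'; rewrite ei in hi; rewrite ej in hj.
have hN : i * k + (k + k) <= n * k.
  by apply: (@leq_trans (i.+2 * k)); rewrite ?leq_mul2r ?hi ?orbT // !mulSn; lia.
(* Counting from 0: entries [0] to [j.+1] of block [i], then entry [x - 2] of block [i.+1]. Here [k]
   is at least 2 because [j.+1 < k]. *)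
pose g x := if x <= j.+1 then i * k + x else i * k + x + (k - 2).
have hg x : x < k.+2 -> g x < n * k.
  by move=> hx; rewrite /g; case: ifP; lia.
have hblk y r : y = r * k -> forall x, 0 < x < k -> y + x < n * k ->
    nth 0 (one_line w) (y + x).-1 < nth 0 (one_line w) (y + x).
  move=> -> x /andP[x0 xk] hx.
  have e : (r * k + x).-1.+1 = r * k + x by rewrite prednK // addn_gt0 x0 orbT.
  rewrite -{2}e; apply: hb; first by rewrite size_one_line e.
  by rewrite e dvdn_addr ?dvdn_mull // gtnNdvd.
exists (mkseq g k.+2); split; last exact: size_mkseq.
- by apply: sorted_mkseq => x hx; rewrite /g /=; do 2![case: ifP]; lia.
- by apply/allP => x /mapP[y]; rewrite mem_iota => /= hy ->; apply: hg.
- rewrite -map_comp; apply: (@sorted_mkseq ltn (nth 0 (one_line w) \o g) k.+2) => x hx /=.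
  have := hg _ hx; rewrite /g => hgx.
  case: (ltngtP x j.+1) hgx => hxj hgx.
  + have := hblk _ i erefl x.+1; rewrite addnS /=; apply; lia.
  + have := hblk _ i.+1 erefl x.-1.
    have -> : (i.+1 * k + x.-1).-1 = i * k + x + (k - 2) by rewrite mulSn; lia.
    have -> : i.+1 * k + x.-1 = i * k + x.+1 + (k - 2) by rewrite mulSn; lia.
    by apply; lia.
  + move: hlt; rewrite hxj /entry -!nth_one_line /= ei ej.
    by congr (nth _ _ _ < nth _ _ _); rewrite mulSn; lia.
Qed.

(** [rsk_asc] translates the increasing blocks and [avoids_id] the avoidance; [L2_of_avoids]
    recovers (L2) from these two. *)
Lemma avoiders_recording_word n k (w : 'S_(n * k)) :
  w \in avoiders (Lset n k) (1%g : 'S_k.+2) <->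
  recording_word n k (rsk (n * k) (one_line w)).2.
Proof.
have hw := one_line_word w.
have asc : blockwise ltn k (one_line w) <-> blockwise geq k (rsk (n * k) (one_line w)).2.
  by split=> h p hp hd; have := h p; rewrite /= ?size_rsk2 in hp * => /(_ hp hd);
     rewrite /= rsk_asc.
rewrite /avoiders /Lset !inE avoids_id; split.
  move=> /andP[/andP[h1 _] h2]; split=> //.
  - exact: lattice_rsk2.
  - exact: rsk2_gt0.
  - by rewrite size_rsk2 size_one_line.
  - exact/asc/L1_blockwise.
move=> [_ _ _ /asc/L1_blockwise h1 h2]; rewrite h1 h2 andbT /=.
by apply: L2_of_avoids; rewrite // avoids_id.
Qed.

(** A relation avoids defining either map explicitly: finite choice extracts both, and they are
    mutually inverse. *)
Lemma finrel_bijective (T1 T2 : finType) (A : {set T1}) (B : {set T2})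
    (R : T1 -> T2 -> Prop) :
  (forall a, a \in A -> exists2 b, b \in B & R a b) ->
  (forall b, b \in B -> exists2 a, a \in A & R a b) ->
  (forall a b b', R a b -> R a b' -> b = b') ->
  (forall a a' b, a \in A -> a' \in A -> b \in B -> R a b -> R a' b -> a = a') ->
  (exists phi : {a | a \in A} -> {b | b \in B}, bijective phi) /\ #|A| = #|B|.
Proof.
move=> hA hB hfun hinj.
have /fin_all_exists[phi hphi] (a : {a | a \in A}) :
    exists b : {b | b \in B}, R (val a) (val b).
  by have [b bB ab] := hA _ (valP a); exists (Sub b bB); rewrite SubK.
have /fin_all_exists[psi hpsi] (b : {b | b \in B}) :
    exists a : {a | a \in A}, R (val a) (val b).
  by have [a aA ab] := hB _ (valP b); exists (Sub a aA); rewrite SubK.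
have phi_bij : bijective phi.
  exists psi => [a|b]; apply: val_inj.
    exact: hinj (valP _) (valP _) (valP _) (hpsi _) (hphi _).
  exact: hfun (hphi _) (hpsi _).
split; first by exists phi.
by have := bij_eq_card phi_bij; rewrite !card_sig.
Qed.

Lemma size_complementary k n u t : complementary k n u t -> size t = n.
Proof.
elim: n u t => [|n IH] u t /=; first by move=> [_ ->].
by move=> [u' [b [d [t' [_ _ -> /IH ht _]]]]]; rewrite /= size_map ht.
Qed.

(** * The bijection between permutations and rectangular tableaux *)

Section Correspondence.

Variables n k : nat.

Let N := n * k.

Lemma sumn_rectangle : sumn (rectangle n k.+1) = n * k + n.
Proof. by rewrite sumn_nseq mulnC mulnS addnC. Qed.

Definition corresponds (w : 'S_N) (T : filling (rectangle n k.+1)) : Prop :=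
  exists2 t, complementary k n (rsk N (one_line w)).2 t &
             row_word ((rsk N (one_line w)).1 ++ t) T.

Lemma size_corresponding (w : 'S_N) t : complementary k n (rsk N (one_line w)).2 t ->
  size ((rsk N (one_line w)).1 ++ t) = sumn (rectangle n k.+1).
Proof.
move=> /size_complementary ht.
by rewrite sumn_rectangle size_cat ht size_rsk1 ?one_line_word.
Qed.

Lemma corresponds_fun w T T' : corresponds w T -> corresponds w T' -> T = T'.
Proof.
move=> [t ht hT] [t' ht' hT']; rewrite -(complementary_fun ht ht') in hT'.
exact: row_word_fun hT hT'.
Qed.

(** The tableau fixes the whole word, and known lengths split it into the insertion word and [t].
    The former gives the shape of the recording word, which together with [t] determines it. *)
Lemma corresponds_inj w w' T : is_syt T ->
  corresponds w T -> corresponds w' T -> w = w'.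
Proof.
move=> hT [t ht h] [t' ht' h'].
have hw := one_line_word w; have hw' := one_line_word w'.
have /eqP := row_word_inj hT (size_corresponding ht) (size_corresponding ht') h h'.
rewrite eqseq_cat ?size_rsk1 // => /andP[/eqP eP /eqP et].
apply/one_line_inj/(rsk_inj hw hw').
rewrite [LHS]surjective_pairing [RHS]surjective_pairing eP; congr pair.
apply: complementary_inj ht _ _; first by rewrite et.
by move=> r; rewrite -!count_rsk // eP.
Qed.

Lemma nth_rectangle r : nth 0 (rectangle n k.+1) r = if r < n then k.+1 else 0.
Proof. exact: nth_nseq. Qed.

Lemma corresponds_total w : w \in avoiders (Lset n k) (1%g : 'S_k.+2) ->
  exists2 T, T \in SYT (rectangle n k.+1) & corresponds w T.
Proof.
move=> /avoiders_recording_word/recording_word_fills_up[t [t1 t2 t3 t4] ht].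
have hw := one_line_word w.
have hy : yamanouchi (rectangle n k.+1) ((rsk N (one_line w)).1 ++ t).
  split; first exact: size_corresponding.
  - apply/lattice_cat; split=> [|i r]; first exact: lattice_rsk1.
    by rewrite !count_rsk.
  (* A permutation inserts every value, so no label [0] remains. *)
  - rewrite mem_cat negb_or t2 andbT; apply/(nthP 0) => -[x].
    rewrite size_rsk1 // => hx e.
    have : slot x (rsk N (one_line w)).1.
      by rewrite /slot (set_nth_default 0) ?e // size_rsk1.
    by rewrite slot_rsk // hx mem_one_line.
  - by move=> r; rewrite count_cat count_rsk // t4 nth_rectangle.
have [T hT] := row_word_exists hy.
by exists T; [rewrite inE; apply: row_word_is_syt hT | exists t].
Qed.

(** The first [n * k] letters of the row word are the insertion word, and the last [n] rebuild the
    recording word; inverse RSK then yields [w]. *)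
Lemma corresponds_onto T : T \in SYT (rectangle n k.+1) ->
  exists2 w, w \in avoiders (Lset n k) (1%g : 'S_k.+2) & corresponds w T.
Proof.
rewrite inE => hT.
have [|s [s1 s2 s3 s4] hs] := row_word_of_syt _ hT.
  by apply/(sortedP 0) => i _; rewrite !nth_rectangle /=; do 2![case: ifP]; lia.
have [P [t [es sP st]]] : exists P t, [/\ s = P ++ t, size P = N & size t = n].
  exists (take N s), (drop N s); rewrite cat_take_drop size_drop.
  by rewrite size_takel s1 sumn_rectangle ?leq_addr // addKn.
rewrite es in s2 s3 s4 hs.
have [hP hPt] := (lattice_cat _ _).1 s2.
have [|u [hu ut eu]] := @fills_up_recording_word n k (fun r => count_mem r.+1 P) t.
  split=> //; first by move: s3; rewrite mem_cat negb_or => /andP[].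
  by move=> r; rewrite -count_cat s4 nth_rectangle.
have [u1 u2 u3 _ _] := hu.
have [v hv ev] := rsk_surj hP u1 u2 (fun r => esym (eu r)).
rewrite sP in hv ev.
have [|w ew] := one_line_surj hv; first by rewrite -(size_rsk2 N) ev.
exists w; first by apply/avoiders_recording_word; rewrite ew ev.
by exists t; rewrite ew ev.
Qed.

End Correspondence.

Theorem theorem4p1 (n k : nat) (hn : 1 <= n) (hk : 1 <= k) :
  (exists phi : {w : 'S_(n * k) | w \in avoiders (Lset n k) (1%g : 'S_k.+2)} ->
                {T : filling (rectangle n k.+1) | T \in SYT (rectangle n k.+1)},
     bijective phi) /\
  #|avoiders (Lset n k) (1%g : 'S_k.+2)| = num_syt (rectangle n k.+1).
Proof.
apply: (finrel_bijective (R := @corresponds n k)).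
- exact: corresponds_total.
- exact: corresponds_onto.
- exact: corresponds_fun.
- by move=> w w' T _ _; rewrite inE; apply: corresponds_inj.
Qed.
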